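(* Let $X$ be a reflexive Banach space, let the set $Q$ be weakly sequentially closed, let the functions $f$ and $\varphi$ be weakly sequentially lower semicontinuous, and let the problem $(\mathcal{P})$: minimize $f(x)$ subject to $x \in M$, $x \in Q$, be weakly Levitin-Polyak well-posed in the extended sense. Then the penalty function $F_c = f + c\varphi$ is globally exact if and only if the following two conditions hold true: 1. $F_c$ is strongly nondegenerate; 2. $F_c$ is uniformly locally exact at globally optimal solutions of $(\mathcal{P})$, that is, $F_c$ is locally exact at every point $x_* \in \operatorname{argmin}(\mathcal{P})$ and there exist $0 < c_* < +\infty$ and $0 < r_* < +\infty$ such that $c_*(x_* ) < c_*$ and $r_*(x_*, c_* ) \ge r_*$ for any $x_* \in \operatorname{argmin}(\mathcal{P})$.
   Context: $M,Q \subset X$ are nonempty, $f \colon X \to \mathbb{R}\cup\{+\infty\}$. The feasible region $\Omega = M \cap Q$ is nonempty and the optimal value $f_* = \inf_{x\in\Omega} f(x)$ is finite; $\operatorname{argmin}(\mathcal{P})$ is the set of globally optimal solutions of $(\mathcal{P})$. Notation: $\operatorname{dist}(x,V) = \inf_{y \in V} \|x-y\|$, $B(x,r) = \{y \in X \mid \|x-y\| \le r\}$. An infeasibility measure (penalty term) for the constraint $x \in M$ on $Q$ is a function $\varphi \colon X \to [0,+\infty]$ such that for any $x \in Q$ one has $\varphi(x)=0 \iff x \in M$; such a $\varphi$ is fixed, and $F_c(x) = f(x) + c\varphi(x)$, $x\in X$, $c \ge 0$. The penalized problem is: minimize $F_c(x)$ subject to $x \in Q$. $(\mathcal{P})$ is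 weakly Levitin-Polyak well-posed in the extended sense if $\operatorname{argmin}(\mathcal{P}) \neq \emptyset$ and for any sequence $\{x_n\}\subset X$ such that $f(x_n)\to f_*$ and $\operatorname{dist}(x_n,\Omega)\to 0$ one has $\operatorname{dist}(x_n,\operatorname{argmin}(\mathcal{P}))\to 0$ (distances in norm). $F_c$ is strongly nondegenerate if there exists $c_0 \ge 0$ such that for any $c \ge c_0$ the function $F_c$ attains a global minimum on $Q$ and there exists $x(c) \in \operatorname{argmin}_{x \in Q} F_c(x)$ such that the set $\{x(c) \mid c \ge c_0\}$ is bounded and $\operatorname{dist}(x(c),\Omega) \to 0$ as $c \to \infty$. $F_c$ is globally exact if there exists $c_* \ge 0$ such that for any $c \ge c_*$ the sets of globally optimal solutions of $(\mathcal{P})$ and of the penalized problem coincide. $F_c$ is locally exact at a locally optimal solution $x_*$ of $(\mathcal{P})$ if there exists $c_* \ge 0$ such that for any $c\ge c_*$ the point $x_*$ is a locally optimal solution of the penalized problem; $c_*(x_* )$ denotes the infimum of all such $c_*$. For such a $c_*$, $r_*(x_*,c_* )$ (the radius of local exactness) is the supremum of all $r>0$ such that $F_c(x) \ge F_c(x_* )$ for all $x \in B(x_*,r)\cap Q$ and all $c \ge c_*$. *)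

(* Defs.v *)
From HB Require Import structures.
From mathcomp Require Import all_boot all_order all_algebra.
From mathcomp Require Import all_classical all_reals all_analysis.
Set Implicit Arguments.
Unset Strict Implicit.
Unset Printing Implicit Defensive.
Import Order.TTheory GRing.Theory Num.Theory.
Import numFieldNormedType.Exports.
Local Open Scope classical_set_scope.
Local Open Scope ring_scope.

Section WeakTopology.
Context {R : realType} {X : normedModType R}.

Definition dual : set (X -> R^o) := [set p | linear p /\ continuous p].

Definition dual_norm (p : X -> R^o) : R :=
  sup [set `|p x| | x in [set x : X | `|x| <= 1]].

(* An element of the bidual is represented by a function on all of
   [X -> R^o] that is linear and bounded on [dual]; its values outside [dual]
   play no role. *)
Definition bidual : set ((X -> R^o) -> R) :=
  [set Phi |
    (forall (a : R) p q, dual p -> dual q ->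
       Phi (a *: p + q) = a * Phi p + Phi q) /\
    (exists C : R, forall p, dual p -> `|Phi p| <= C * dual_norm p)].

Definition weakly_cvg (u : nat -> X) (x : X) : Prop :=
  forall p, dual p -> p (u n) @[n --> \oo] --> p x.

Definition weakly_seq_closed (A : set X) : Prop :=
  forall (u : nat -> X) (x : X),
    (forall n, A (u n)) -> weakly_cvg u x -> A x.

Definition weakly_seq_lsc (g : X -> \bar R) : Prop :=
  forall (u : nat -> X) (x : X),
    weakly_cvg u x -> (g x <= limn_einf (g \o u))%E.

End WeakTopology.

(* The canonical embedding of X into its bidual is onto. *)
Definition reflexive_space (R : realType) (X : normedModType R) : Prop :=
  forall Phi : (X -> R^o) -> R, bidual Phi ->
    exists x : X, forall p, dual p -> Phi p = p x.

Section Penalty.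
Context {R : realType} {X : normedModType R}.
Local Open Scope ereal_scope.

Definition dist (x : X) (V : set X) : \bar R :=
  ereal_inf [set `|x - y|%:E | y in V].

Definition argmin (g : X -> \bar R) (A : set X) : set X :=
  [set x | A x /\ forall y, A y -> g x <= g y].

Definition locally_optimal (g : X -> \bar R) (A : set X) (x : X) : Prop :=
  A x /\ \forall y \near x, A y -> g x <= g y.

Definition optimal_value (g : X -> \bar R) (A : set X) : \bar R :=
  ereal_inf (g @` A).

Definition infeasibility_measure (M Q : set X) (phi : X -> \bar R) : Prop :=
  (forall x, 0 <= phi x) /\ (forall x, Q x -> (phi x = 0 <-> M x)).

(* The convention [0 * +oo = 0] of [\bar R] is in force when [c = 0]. *)
Definition penalty_fun (f phi : X -> \bar R) (c : R) (x : X) : \bar R :=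
  f x + c%:E * phi x.

Definition weakly_LP_wellposed_ext (f : X -> \bar R) (M Q : set X) : Prop :=
  argmin f (M `&` Q) !=set0 /\
  forall u : nat -> X,
    f (u n) @[n --> \oo] --> optimal_value f (M `&` Q) ->
    dist (u n) (M `&` Q) @[n --> \oo] --> 0 ->
    dist (u n) (argmin f (M `&` Q)) @[n --> \oo] --> 0.

Definition strongly_nondegenerate (f phi : X -> \bar R) (M Q : set X) : Prop :=
  exists c0 : R, (0 <= c0)%R /\
    (forall c : R, (c0 <= c)%R -> argmin (penalty_fun f phi c) Q !=set0) /\
    exists xc : R -> X,
      [/\ forall c : R, (c0 <= c)%R -> argmin (penalty_fun f phi c) Q (xc c),
          bounded_set [set xc c | c in [set c : R | (c0 <= c)%R]] &
          dist (xc c) (M `&` Q) @[c --> +oo%R] --> 0].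

Definition globally_exact (f phi : X -> \bar R) (M Q : set X) : Prop :=
  exists cstar : R, (0 <= cstar)%R /\
    forall c : R, (cstar <= c)%R ->
      argmin (penalty_fun f phi c) Q = argmin f (M `&` Q).

Definition local_exactness_params (f phi : X -> \bar R) (Q : set X) (x : X)
    : set R :=
  [set cstar | (0 <= cstar)%R /\
    forall c : R, (cstar <= c)%R -> locally_optimal (penalty_fun f phi c) Q x].

Definition locally_exact_at (f phi : X -> \bar R) (M Q : set X) (x : X)
    : Prop :=
  locally_optimal f (M `&` Q) x /\ local_exactness_params f phi Q x !=set0.

Definition least_exact_param (f phi : X -> \bar R) (Q : set X) (x : X)
    : \bar R :=
  ereal_inf [set c%:E | c in local_exactness_params f phi Q x].

Definition local_exactness_radius (f phi : X -> \bar R) (Q : set X)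
    (x : X) (cstar : R) : \bar R :=
  ereal_sup [set r%:E | r in [set r : R | (0 < r)%R /\
    forall y, closed_ball_ Num.norm x r y -> Q y ->
      forall c : R, (cstar <= c)%R ->
        penalty_fun f phi c x <= penalty_fun f phi c y]].

Definition uniformly_locally_exact (f phi : X -> \bar R) (M Q : set X)
    : Prop :=
  (forall x, argmin f (M `&` Q) x -> locally_exact_at f phi M Q x) /\
  exists cstar rstar : R,
    [/\ (0 < cstar)%R, (0 < rstar)%R &
      forall x, argmin f (M `&` Q) x ->
        least_exact_param f phi Q x < cstar%:E /\
        rstar%:E <= local_exactness_radius f phi Q x cstar].

End Penalty.

(* Main.v *)
(* Global exactness makes every optimal solution of the problem a minimizer of
   all penalty functions with a large parameter, which gives both conditions
   with a constant family of minimizers. Conversely, bounded minimizers x(c_n)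
   with c_n -> +oo have a weakly convergent subsequence; lower semicontinuity
   together with F_c(x(c)) <= f_* forces the limit to be feasible and
   f(x(c_n)) -> f_*, so well-posedness brings x(c_n) within the uniform radius
   of local exactness of some optimal solution x, and then
   f_* = F_c(x) <= F_c(x(c)) = min_Q F_c at that single parameter c. This bound
   implies exactness for every larger parameter.

   Weak sequential compactness of bounded sequences (u_n) in a reflexive space:
   limits of p(u_n) along an ultrafilter define an element of the bidual, hence
   a weak cluster point x, which by Hahn-Banach lies in the closure of the
   countable rational span D of the u_n. Choose terms of the sequence on which
   the countably many functionals norming the elements of D converge to their
   values at x; these functionals separate points of the closure of D, so x is
   the only weak cluster point of the chosen terms. *)
Require Import Defs.
From HB Require Import structures.
From mathcomp Require Import all_boot all_order all_algebra.
From mathcomp Require Import all_classical all_reals all_analysis.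
From mathcomp Require Import lra.
Import Order.TTheory GRing.Theory Num.Theory.
Import numFieldNormedType.Exports.
Local Open Scope classical_set_scope.
Local Open Scope ring_scope.

(** * Hahn-Banach theorem via minimal sublinear functionals *)

Section HahnBanach.
Context {R : realType} {V : lmodType R}.
Implicit Types (p q : V -> R) (x y : V).

Definition sublinear q : Prop :=
  (forall x y, q (x + y) <= q x + q y) /\
  (forall (t : R) x, 0 <= t -> q (t *: x) <= t * q x).

Lemma sublinear0 q : sublinear q -> q 0 = 0.
Proof.
move=> [qD qZ]; have := qZ 0 0 (lexx 0); have := qD 0 0.
rewrite scale0r addr0; lra.
Qed.

Lemma sublinearN_ge q x : sublinear q -> - q (- x) <= q x.
Proof.
move=> sq; have := sq.1 x (- x); rewrite subrr sublinear0//; lra.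
Qed.

Lemma sublinearZ q (t : R) x : sublinear q -> 0 <= t -> q (t *: x) = t * q x.
Proof.
move=> sq; rewrite le_eqVlt => /predU1P[<-|t0].
  by rewrite scale0r mul0r sublinear0.
apply/eqP; rewrite eq_le (sq.2 _ _ (ltW t0))/=.
have := sq.2 t^-1 (t *: x); rewrite invr_ge0 ltW// => /(_ isT).
by rewrite scalerK ?gt_eqF// ler_pdivlMl.
Qed.

(** Shared by tilts, chains of functionals and the distance to a rational span. The slack [e] in the
    scaling condition serves the last of these, where a real factor is only approximated by rational
    ones. *)
Lemma inf_sublinear {I : Type} (A : set I) (g : I -> V -> R) :
  A !=set0 ->
  (forall x, has_lbound [set g i x | i in A]) ->
  (forall i j x y, A i -> A j ->
    exists2 k, A k & g k (x + y) <= g i x + g j y) ->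
  (forall i (t : R) x (e : R), A i -> 0 <= t -> 0 < e ->
    exists2 k, A k & g k (t *: x) <= t * g i x + e) ->
  sublinear (fun x => inf [set g i x | i in A]).
Proof.
move=> [i0 Ai0] lb gD gZ.
have hi x : has_inf [set g i x | i in A] by split; [exists (g i0 x), i0|].
split=> [x y|t x t0]; apply/ler_addgt0Pr => e e0.
  have [_ [i Ai <-] gi] := inf_adherent (divr_gt0 e0 (ltr0Sn R 1)) (hi x).
  have [_ [j Aj <-] gj] := inf_adherent (divr_gt0 e0 (ltr0Sn R 1)) (hi y).
  have [k Ak gk] := gD i j x y Ai Aj.
  have := @ge_inf _ _ (lb (x + y)) (g k (x + y)) (imageP _ Ak).
  lra.
(* Dividing by [t + 1] rather than [t] covers [t = 0], and [t] times the tolerance stays at most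
   [e / 2]. *)
have t1 : 0 < t + 1 by rewrite ltr_wpDl.
have d0 : 0 < e / 2 / (t + 1) by rewrite !divr_gt0.
have [_ [i Ai <-] gi] := inf_adherent d0 (hi x).
have [k Ak gk] := gZ i t x (e / 2) Ai t0 (divr_gt0 e0 (ltr0Sn R 1)).
have := @ge_inf _ _ (lb (t *: x)) (g k (t *: x))
  (imageP (fun i => g i (t *: x)) Ak).
have : t * g i x <= t * (inf [set g i x | i in A] + e / 2 / (t + 1)).
  by rewrite ler_wpM2l// ltW.
have : t * (e / 2 / (t + 1)) <= e / 2.
  by rewrite mulrCA ler_piMr// ?divr_ge0 ?ltW// ltr_pdivrMr// mul1r ltrDl.
rewrite mulrDr; lra.
Qed.

(* The largest sublinear functional below [q] whose value at [- x0] is at most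
   [- q x0]; hence a minimal sublinear functional is odd. *)
Definition tilt q x0 x : R :=
  inf [set q (x + t *: x0) - t * q x0 | t in [set t : R | 0 <= t]].

Section tilt.
Variables (q : V -> R) (x0 : V).
Hypothesis sq : sublinear q.

Let tilt_lbound x :
  has_lbound [set q (x + t *: x0) - t * q x0 | t in [set t : R | 0 <= t]].
Proof.
exists (- q (- x)) => _ [t /= t0 <-].
rewrite -sublinearZ//.
have := sq.1 (x + t *: x0) (- x).
rewrite addrAC subrr add0r; lra.
Qed.

Lemma tilt_sublinear : sublinear (tilt q x0).
Proof.
apply: (@inf_sublinear _ _ (fun t x => q (x + t *: x0) - t * q x0)).
- by exists 0 => /=.
- exact: tilt_lbound.
- move=> s t x y /= s0 t0; exists (s + t); first exact: addr_ge0.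
  have := sq.1 (x + s *: x0) (y + t *: x0).
  by rewrite addrACA -scalerDl mulrDl; lra.
- move=> s t x e /= s0 t0 e0; exists (t * s); first exact: mulr_ge0.
  rewrite -scalerA -scalerDr sublinearZ// mulrBr mulrA; lra.
Qed.

Lemma tilt_le x : tilt q x0 x <= q x.
Proof.
have := @ge_inf _ _ (tilt_lbound x) (q x).
by apply; exists 0 => //=; rewrite scale0r addr0 mul0r subr0.
Qed.

Lemma tiltN_le : tilt q x0 (- x0) <= - q x0.
Proof.
have := @ge_inf _ _ (tilt_lbound (- x0)) (- q x0).
apply; exists 1 => //=; rewrite scale1r addNr mul1r.
by rewrite sublinear0// sub0r.
Qed.

End tilt.

(** Zorn's lemma for the reversed pointwise order: the infimum of a chain is again sublinear, since
    [- q (- x)] bounds it below. *)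
Lemma exists_minimal_sublinear q : sublinear q ->
  exists p, [/\ sublinear p, (forall x, p x <= q x) &
    forall p', sublinear p' -> (forall x, p' x <= p x) -> p' = p].
Proof.
move=> sq.
pose T := {p : V -> R | sublinear p /\ forall x, p x <= q x}.
pose q0 : T := exist _ q (conj sq (fun x => lexx _)).
pose leT (a b : T) : bool := `[< forall x, sval b x <= sval a x >].
have [||A totA|[p [sp pq]] pmax] := @ZL_preorder T q0 leT.
- by move=> a; apply/asboolP.
- move=> b a c /asboolP ab /asboolP bc; apply/asboolP => x.
  exact: le_trans (bc x) (ab x).
- have [->|/set0P[a0 Aa0]] := eqVneq A set0; first by exists q0.
  have lb x : has_lbound [set sval a x | a in A].
    exists (- q (- x)) => _ [[a [sa aq]] /= Aa <-].
    by apply: le_trans (sublinearN_ge a x sa); rewrite lerN2.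
  have sinf : sublinear (fun x => inf [set sval a x | a in A]).
    apply: (@inf_sublinear _ _ (fun a : T => sval a)) => //.
    + by exists a0.
    + move=> a b x y Aa Ab; have [/asboolP ab|/asboolP ba] := totA _ _ Aa Ab.
      * exists b => //; apply: le_trans ((svalP b).1.1 _ _) _.
        by rewrite lerD2r ab.
      * exists a => //; apply: le_trans ((svalP a).1.1 _ _) _.
        by rewrite lerD2l ba.
    + move=> a t x e Aa t0 e0; exists a => //.
      by rewrite (sublinearZ _ _ _ (svalP a).1)// lerDl ltW.
  have infle a x : A a -> inf [set sval a x | a in A] <= sval a x.
    by move=> Aa; apply: ge_inf => //; exists a.
  have infq x : inf [set sval a x | a in A] <= q x.
    exact: le_trans (infle _ _ Aa0) ((svalP a0).2 x).
  exists (exist (fun p => sublinear p /\ forall x, p x <= q x) _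
    (conj sinf infq)) => a Aa; apply/asboolP => x /=.
  exact: infle.
- exists p; split=> // p' sp' p'p.
  have p'q x : p' x <= q x := le_trans (p'p x) (pq x).
  have /asboolP /= h := pmax (exist _ p' (conj sp' p'q)) (introT (asboolP _) p'p).
  by apply/funext => x; apply/eqP; rewrite eq_le p'p h.
Qed.

(** A minimal [p] below [tilt q x0] equals all its own tilts, which makes it odd and hence linear.
    Lying below the tilt also gives [p (- x0) <= - q x0], whence equality at [x0]. *)
Lemma hahn_banach_point q x0 : sublinear q ->
  exists p : V -> R^o, [/\ linear p, (forall x, p x <= q x) & p x0 = q x0].
Proof.
move=> sq.
have [p [sp ple pmin]] := exists_minimal_sublinear _ (tilt_sublinear _ x0 sq).
have tiltp x : tilt p x = p by apply: pmin; [exact: tilt_sublinear|exact: tilt_le].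
have pN x : p (- x) = - p x.
  apply/eqP; rewrite eq_le -{1}[in leLHS](tiltp x) tiltN_le//=.
  by rewrite lerNl sublinearN_ge.
have pD x y : p (x + y) = p x + p y.
  apply/eqP; rewrite eq_le sp.1 /=.
  have := sp.1 (x + y) (- y); rewrite addrK pN; lra.
have pq x : p x <= q x := le_trans (ple x) (tilt_le _ _ sq x).
exists p; split=> //.
- move=> a x y; rewrite pD; congr (_ + _).
  have [a0|a0] := leP 0 a; first by rewrite (sublinearZ _ _ _ sp).
  rewrite -[a]opprK scaleNr pN (sublinearZ _ _ _ sp) ?oppr_ge0 1?ltW//.
  by rewrite scaleNr.
- apply/eqP; rewrite eq_le pq /=; rewrite -lerN2 -pN.
  exact: le_trans (ple _) (tiltN_le _ _ sq).
Qed.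

End HahnBanach.

(** * Continuous linear functionals and the dual norm *)

Section Dual.
Context {R : realType} {X : normedModType R}.
Implicit Types (p : X -> R^o) (x y : X).

Lemma linear_fun_of p : linear p -> exists g : {linear X -> R^o}, p = g.
Proof.
move=> lp; pose L := GRing.isLinear.Build R X R^o *:%R p lp.
by pose g : {linear X -> R^o} := HB.pack p L; exists g.
Qed.

Lemma dominated_norm_le p : linear p -> (forall x, p x <= `|x|) ->
  forall x, `|p x| <= `|x|.
Proof.
move=> /linear_fun_of[g ->] ple x; rewrite ler_norml ple andbT lerNl -linearN.
by rewrite -normrN; exact: ple.
Qed.

Lemma dominated_dual p : linear p -> (forall x, p x <= `|x|) -> dual p.
Proof.
move=> lp ple; split=> //; have := dominated_norm_le _ lp ple.
have [g ->] := linear_fun_of _ lp => gle.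
apply/linear_bounded_continuous/linear_boundedP.
near=> r => x; apply: (le_trans (gle x)); rewrite ler_peMl//.
Unshelve. all: by end_near. Qed.

Lemma dual_norm_ub p y : dual p -> `|y| <= 1 -> `|p y| <= dual_norm p.
Proof.
move=> [lp cp] y1; have [g pg] := linear_fun_of _ lp; rewrite pg in cp *.
have /linear_boundedP/pinfty_ex_gt0[r r0 gr] :=
  (linear_bounded_continuous g).2 cp.
apply: ub_le_sup; last by exists y.
exists r => _ [z /= z1 <-]; apply: (le_trans (gr z)).
by rewrite ler_piMr// ltW.
Qed.

Lemma dual_norm_ge0 p : dual p -> 0 <= dual_norm p.
Proof.
by move=> dp; apply: le_trans (dual_norm_ub p 0 dp _); rewrite ?normr0.
Qed.

Lemma dual_norm_ge p x : dual p -> `|p x| <= dual_norm p * `|x|.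
Proof.
move=> dp; have [g pg] := linear_fun_of _ dp.1.
have [->|x0] := eqVneq x 0; first by rewrite pg linear0 !normr0 mulr0.
have nx0 : 0 < `|x| by rewrite normr_gt0.
have /(dual_norm_ub _ _ dp) : `| `|x|^-1 *: x| <= 1.
  by rewrite normrZ ger0_norm ?invr_ge0// mulVf// gt_eqF.
rewrite pg linearZ /= normrZ ger0_norm ?invr_ge0//.
by rewrite ler_pdivrMl// mulrC.
Qed.

Lemma exists_norming_functional x :
  exists p, [/\ dual p, forall y, `|p y| <= `|y| & p x = `|x|].
Proof.
have sn : sublinear (fun y : X => `|y|).
  by split=> [y z|t y t0]; [exact: ler_normD|rewrite normrZ ger0_norm].
have [p [lp ple px]] := hahn_banach_point _ x sn.
by exists p; split=> //; [exact: dominated_dual|exact: dominated_norm_le].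
Qed.

End Dual.

(** * Weak limits along ultrafilters *)

Section UltraLimit.
Context {R : realType}.

(** Compactness of [[-B, B]] gives a cluster point. For each of its neighbourhoods the ultrafilter
    contains the preimage or the complement of the preimage, and clustering excludes the latter. *)
Lemma ultra_bounded_cvg {T : Type} (U : set_system T) (f : T -> R) (B : R) :
  UltraFilter U -> (forall t, `|f t| <= B) -> exists l : R, f @ U --> l.
Proof.
move=> UU fB.
have fU : (f @ U) `[- B, B]%classic.
  by apply: (@filterE _ U) => t; rewrite /= in_itv/= -ler_norml.
have [l [_ cl]] := @segment_compact R (- B) B (f @ U) _ fU.
exists l => A nA; have [//|UAC] := in_ultra_setVsetC (f @^-1` A) UU.
by have [z [/= ]] := cl (~` A) A UAC nA.
Qed.

Lemma weak_ultra_cvg {X : normedModType R} {T : Type} (U : set_system T)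
    (u : T -> X) (B : R) :
  reflexive_space X -> UltraFilter U -> (forall t, `|u t| <= B) ->
  exists x, forall p, dual p -> p (u t) @[t --> U] --> p x.
Proof.
move=> rX UU uB.
pose Phi (p : X -> R^o) : R := lim (p (u t) @[t --> U]).
have cvgPhi p : dual p -> p (u t) @[t --> U] --> Phi p.
  move=> dp; have [t|l pl] := @ultra_bounded_cvg T U (p \o u) (dual_norm p * B) UU.
    apply: (le_trans (dual_norm_ge _ _ dp)).
    by rewrite ler_wpM2l// dual_norm_ge0.
  by rewrite /Phi (cvg_lim _ pl).
suff /rX[x Px] : bidual Phi by exists x => p dp; rewrite -Px//; exact: cvgPhi.
split.
  move=> a p q dp dq; apply: cvg_lim => //=.
  by apply: cvgD; [apply: cvgMr; exact: cvgPhi|exact: cvgPhi].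
exists B => p dp.
have nPhi : `|p (u t)| @[t --> U] --> `|Phi p|.
  by apply: cvg_norm; exact: cvgPhi.
rewrite -(cvg_lim (@norm_hausdorff _ _) nPhi).
apply: limr_le; first by apply/cvg_ex; exists `|Phi p|.
apply: filterE => t; apply: (le_trans (dual_norm_ge _ _ dp)).
by rewrite mulrC ler_wpM2r// dual_norm_ge0.
Qed.

End UltraLimit.

(** * Rational span of a sequence and the distance to it *)

Section RationalSpan.
Context {R : realType} {X : normedModType R}.
Variable u : nat -> X.

(* Indexing the rational combinations of [u] by polynomials makes the index
   set canonically countable and closed under sums and scaling. *)
Definition rat_comb (P : {poly rat}) : X :=
  \sum_(i < size P) ratr P`_i *: u i.

Let rat_comb_wide (n : nat) (P : {poly rat}) : (size P <= n)%N ->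
  rat_comb P = \sum_(i < n) ratr P`_i *: u i.
Proof.
move=> Pn; rewrite /rat_comb (big_ord_widen n (fun i => ratr P`_i *: u i) Pn) big_mkcond.
apply: eq_bigr => i _; case: ifPn => // iP.
by rewrite nth_default ?raddf0 ?scale0r// leqNgt.
Qed.

Lemma rat_combD P Q : rat_comb (P + Q) = rat_comb P + rat_comb Q.
Proof.
rewrite (rat_comb_wide _ _ (size_polyD P Q)).
rewrite (rat_comb_wide _ P (leq_maxl _ (size Q))).
rewrite (rat_comb_wide _ Q (leq_maxr (size P) _)) -big_split.
by apply: eq_bigr => i _; rewrite coefD raddfD scalerDl.
Qed.

Lemma rat_combZ (r : rat) P : rat_comb (r *: P) = ratr r *: rat_comb P.
Proof.
rewrite (rat_comb_wide _ _ (size_scale_leq r P)) scaler_sumr.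
by apply: eq_bigr => i _; rewrite coefZ rmorphM scalerA.
Qed.

Lemma rat_comb_Xn n : rat_comb 'X^n = u n.
Proof.
rewrite /rat_comb size_polyXn big_ord_recr /= big1 ?add0r; last first.
  by move=> i _; rewrite coefXn ltn_eqF// raddf0 scale0r.
by rewrite coefXn eqxx rmorph1 scale1r.
Qed.

Definition rat_dist x : R :=
  inf [set `|x - rat_comb P| | P in [set: {poly rat}]].

Let rat_dist_lbound x : has_lbound [set `|x - rat_comb P| | P in setT].
Proof. by exists 0 => _ [P _ <-]. Qed.

Lemma rat_dist_le x P : rat_dist x <= `|x - rat_comb P|.
Proof. by apply: ge_inf => //; exists P. Qed.

Lemma rat_dist_lt x (e : R) : rat_dist x < e -> exists P, `|x - rat_comb P| < e.
Proof.
move=> /inf_lt[|_ [P _ <-] Pe]; last by exists P.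
by exists `|x - rat_comb 0|, 0.
Qed.

Lemma rat_dist_sublinear : sublinear rat_dist.
Proof.
apply: (@inf_sublinear _ _ _ _ (fun P x => `|x - rat_comb P|)) => //.
- by exists 0.
- move=> P Q x y _ _; exists (P + Q) => //.
  by rewrite rat_combD opprD addrACA ler_normD.
- move=> P t x e _ t0 e0.
  have n0 : 0 < `|rat_comb P| + 1 by rewrite ltr_wpDl.
  (* A rational just above [t], so close that the excess times [|rat_comb P|] is at most [e]. *)
  have [r] : exists r, ratr r \in `]t, t + e / (`|rat_comb P| + 1)[.
    by apply: rat_in_itvoo; rewrite ltrDl divr_gt0.
  rewrite in_itv/= => /andP[tr re]; exists (r *: P) => //.
  have -> : t *: x - rat_comb (r *: P) =
      t *: (x - rat_comb P) - (ratr r - t) *: rat_comb P.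
    by rewrite rat_combZ scalerBr scalerBl opprB addrA subrK.
  apply: (le_trans (ler_normB _ _)).
  rewrite !normrZ ger0_norm// lerD2l ger0_norm ?subr_ge0 ?(ltW tr)//.
  apply: (@le_trans _ _ (e / (`|rat_comb P| + 1) * `|rat_comb P|)).
    by rewrite ler_wpM2r// lerBlDl ltW.
  by rewrite mulrAC ler_pdivrMr// ler_pM2l// lerDl.
Qed.

(** A linear functional below [rat_dist] and equal to it at [x] vanishes on every [u n], because
    [rat_dist] is zero at [u n] and at [- u n]. Its value at the weak limit [x] is then zero. *)
Lemma rat_dist_weak_limit {T : Type} (F : set_system T) {FF : ProperFilter F}
    (w : T -> nat) x :
  (forall p : X -> R^o, dual p -> p (u (w t)) @[t --> F] --> p x) ->
  rat_dist x = 0.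
Proof.
move=> wx; have [p [lp ple <-]] := hahn_banach_point _ x rat_dist_sublinear.
have dp : dual p.
  apply: dominated_dual => // y; apply: (le_trans (ple y)).
  apply: (le_trans (rat_dist_le y 0)).
  by rewrite /rat_comb size_poly0 big_ord0 subr0.
have pu n : p (u n) = 0.
  have pP P : p (rat_comb P) <= 0.
    apply: (le_trans (ple _)); apply: (le_trans (rat_dist_le _ P)).
    by rewrite subrr normr0.
  apply/eqP; rewrite eq_le -{1}rat_comb_Xn pP/=.
  have := pP (-1 *: 'X^n); rewrite rat_combZ rat_comb_Xn rmorphN1 scaleN1r.
  by have [g ->] := linear_fun_of _ lp; rewrite linearN oppr_le0.
have pw0 : p (u (w t)) @[t --> F] --> (0 : R^o).
  by under eq_fun do rewrite pu; exact: cvg_cst.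
exact: (@norm_cvg_unique _ R^o _ _ _ _ (wx _ dp) pw0).
Qed.

End RationalSpan.

(** * Weak sequential compactness in reflexive spaces *)

Section WeakSequentialCompactness.
Context {R : realType} {X : normedModType R}.

(* The functionals norming the countable set [rat_comb u] separate the points
   of its closure, which contains every weak cluster point of a sequence drawn
   from [u]. *)
Lemma rat_comb_separated (u : nat -> X) (p : {poly rat} -> X -> R^o) x y :
  (forall P, [/\ dual (p P), forall z, `|p P z| <= `|z| &
    p P (rat_comb u P) = `|rat_comb u P|]) ->
  rat_dist u x = 0 -> rat_dist u y = 0 -> (forall P, p P x = p P y) -> x = y.
Proof.
move=> hp x0 y0 pxy; apply/subr0_eq/eqP; rewrite -normr_le0.
apply/ler_addgt0Pr => e e0; rewrite add0r.
have [|P xP] := rat_dist_lt u x (e / 4); first by rewrite x0 divr_gt0.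
have [|Q yQ] := rat_dist_lt u y (e / 4); first by rewrite y0 divr_gt0.
pose S := P + (-1) *: Q.
have dS : `|x - y - rat_comb u S| <= e / 2.
  have -> : x - y - rat_comb u S = (x - rat_comb u P) - (y - rat_comb u Q).
    rewrite rat_combD rat_combZ rmorphN1 scaleN1r !opprD addrACA.
    by rewrite opprK.
  by apply: (le_trans (ler_normB _ _)); lra.
have [[lS _] bS pS] := hp S.
(* The functional norming [rat_comb u S] vanishes at [x - y], so this norm is bounded by the
   approximation error [dS]. *)
have nS : `|rat_comb u S| <= e / 2.
  rewrite -pS (le_trans (ler_norm _))// (le_trans _ dS)//.
  have -> : p S (rat_comb u S) = - p S (x - y - rat_comb u S).
    move: (pxy S); have [g ->] := linear_fun_of _ lS.
    by rewrite !linearB /= => ->; rewrite subrr sub0r opprK.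
  by rewrite normrN.
have := ler_normD (x - y - rat_comb u S) (rat_comb u S).
rewrite subrK; lra.
Qed.

(* [n_] need not be increasing: [k <= n_ k] makes [u \o n_] tend to its limit
   along indices tending to infinity. *)
Theorem bounded_weakly_cvg_subseq (u : nat -> X) (B : R) :
  reflexive_space X -> (forall n, `|u n| <= B) ->
  exists (n_ : nat -> nat) (x : X),
    (forall k, (k <= n_ k)%N) /\ weakly_cvg (u \o n_) x.
Proof.
move=> rX uB.
have [U [UU ooU]] := @ultraFilterLemma nat \oo _.
have [x xU] := weak_ultra_cvg U u B rX UU uB.
have /choice[p hp] := fun P => exists_norming_functional (rat_comb u P).
(* Stage [k] tests the functionals with code at most [k] to within [1 / (k + 1)]; codes that decode
   to nothing impose no condition. *)
pose close k n i := if unpickle i is Some P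
  then `|p P x - p P (u n)| < k.+1%:R^-1 else true.
have /choice[n_ hn] : forall k, exists n,
    (k <= n)%N /\ forall i : 'I_k.+1, close k n i.
  move=> k; apply: (@filter_ex _ U); apply: filterI.
    by apply: ooU; exists k.
  apply: filter_forall => i; rewrite /close.
  case: (unpickle i) => [P|]; last exact: filterE.
  have [dP _ _] := hp P.
  by move/cvgrPdist_lt : (xU _ dP); apply; rewrite invr_gt0.
have pn P : p P (u (n_ k)) @[k --> \oo] --> p P x.
  apply/cvgrPdist_lt => e e0; near=> k.
  have Pk : (pickle P <= k)%N by near: k; exact: nbhs_infty_ge.
  have := (hn k).2 (@Ordinal k.+1 _ Pk); rewrite /close /= pickleK => /lt_trans; apply.
  near: k; exact: near_infty_natSinv_lt (PosNum e0).
exists n_, x; split=> [k|p0 dp0]; first exact: (hn k).1.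
apply: contrapT => /cvgrPdist_lt /existsNP[e /not_implyP[e0 ne]].
(* If [p0] fails to converge, the bad indices [A] meet every tail, so some ultrafilter [G] finer
   than [\oo] contains [A]. Its weak limit [y] must equal [x], which contradicts [A]. *)
pose A := [set k | ~ `|p0 x - p0 (u (n_ k))| < e].
have WP : ProperFilter (within A \oo).
  apply: Build_ProperFilter => wA0; apply: ne.
  move: wA0; rewrite /within /= => wA0.
  by apply: (@filterS _ \oo _ _ _ _ wA0) => k nAk; apply: contrapT.
have [G [GG wG]] := @ultraFilterLemma nat (within A \oo) WP.
have [y yG] := weak_ultra_cvg G (u \o n_) B rX GG (fun k => uB (n_ k)).
have ooG : \oo `<=` G by apply: subset_trans wG; exact: cvg_within.
have xy : x = y.
  apply: (rat_comb_separated u p _ _ hp).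
  - exact: (rat_dist_weak_limit u U id).
  - exact: (rat_dist_weak_limit u G n_).
  - move=> P; have [dP _ _] := hp P.
    have pG : p P (u (n_ k)) @[k --> G] --> p P x.
      by move=> D /pn; exact: ooG.
    exact: (@norm_cvg_unique _ R^o _ _ _ _ pG (yG _ dP)).
have GA : G A by apply: wG; exact: withinT.
have /cvgrPdist_lt/(_ _ e0) Ge := yG _ dp0.
have [k [/= Ak]] := filter_ex (filterI GA Ge).
by rewrite -xy.
Unshelve. all: by end_near. Qed.

End WeakSequentialCompactness.

(** * Exactness of the penalty function *)

Section Exactness.
Context {R : realType}.
Local Open Scope ereal_scope.

Lemma lt_limn_einf (v : nat -> \bar R) (y : \bar R) :
  y < limn_einf v -> \forall n \near \oo, y < v n.
Proof.
rewrite limn_einf_lim (cvg_lim _ (@cvg_einfs_sup _ v))//.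
move=> /ereal_sup_gt[_ [m _ <-]] ym; exists m => // n /= mn.
by apply: (lt_le_trans ym); apply: ereal_inf_lbound; exists n.
Qed.

Lemma lte_dense0 (y : \bar R) : 0 < y -> exists2 e : R, (0 < e)%R & e%:E < y.
Proof.
case: y => [r|_|//]; last by exists 1%R; rewrite ?ltry.
by rewrite lte_fin => r0; exists (r / 2)%R; rewrite ?divr_gt0// lte_fin; lra.
Qed.

Context {X : normedModType R}.
Variables (M Q : set X) (f phi : X -> \bar R).
Hypotheses (hf : forall x, -oo < f x) (hphi : infeasibility_measure M Q phi).
Hypothesis fstar_fin : optimal_value f (M `&` Q) \is a fin_num.

Lemma argmin_value (g : X -> \bar R) (A : set X) x :
  argmin g A x -> optimal_value g A = g x.
Proof.
move=> [Ax gx]; apply/eqP; rewrite eq_le; apply/andP; split.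
  by apply: ereal_inf_lbound; exists x.
by apply: le_ereal_inf_tmp => _ [y Ay <-]; exact: gx.
Qed.

Lemma penalty_feasible (c : R) x : (M `&` Q) x -> penalty_fun f phi c x = f x.
Proof.
by move=> [Mx Qx]; rewrite /penalty_fun (hphi.2 x Qx).2// mule0 adde0.
Qed.

Lemma le_penalty (c d : R) x : (c <= d)%R ->
  penalty_fun f phi c x <= penalty_fun f phi d x.
Proof. by move=> cd; rewrite leeD2l// lee_wpmul2r ?lee_fin//; exact: hphi.1. Qed.

Lemma le_penalty0 (c : R) x : (0 <= c)%R -> f x <= penalty_fun f phi c x.
Proof. by move=> c0; rewrite leeDl// mule_ge0 ?lee_fin//; exact: hphi.1. Qed.

(** For [d >= c + 1], a minimizer [x] of [F_d] on [Q] satisfies [F_d x <= f_* <= F_c x]. If [phi x]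
    is finite, then [(d - c) * phi x <= 0] forces it to vanish; an infinite [phi x] is excluded
    because [d > 0] makes [F_d x] infinite. *)
Lemma penalty_bound_globally_exact (c : R) :
  (0 <= c)%R -> argmin f (M `&` Q) !=set0 ->
  (forall x, Q x -> optimal_value f (M `&` Q) <= penalty_fun f phi c x) ->
  globally_exact f phi M Q.
Proof.
move=> c0 [x0 ax0] Fc; exists (c + 1)%R; split=> [|d cd]; first by rewrite addr_ge0.
have le_cd : (c <= d)%R by apply: le_trans cd; rewrite lerDl.
apply/seteqP; split=> x; last first.
  move=> ax; have [Mx fx] := ax; split=> [|y Qy]; first exact: Mx.2.
  rewrite penalty_feasible// -(argmin_value _ _ _ ax).
  exact: le_trans (Fc y Qy) (le_penalty _ _ _ le_cd).
move=> [Qx Fx].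
have Fle : penalty_fun f phi d x <= optimal_value f (M `&` Q).
  rewrite (argmin_value _ _ _ ax0) -(penalty_feasible d x0 ax0.1).
  exact: Fx ax0.1.2.
have phix : phi x = 0.
  have fle := le_trans (le_penalty0 d x (le_trans c0 le_cd)) Fle.
  have := hf x; have := hphi.1 x; have := Fc x Qx; move: fle Fle.
  rewrite -(fineK fstar_fin) /penalty_fun.
  case: (f x) => [r _||]//.
  case: (phi x) => [s||]//; last first.
    by rewrite gt0_muley ?lte_fin//; lra.
  rewrite -!EFinM -!EFinD !lee_fin => h1 h2 h3 _.
  by congr EFin; nra.
have Mx : M x by apply/(hphi.2 x Qx).
split=> // y [My Qy].
rewrite -(penalty_feasible d x)// (le_trans Fle)//.
by apply: ereal_inf_lbound; exists y.
Qed.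

Lemma globally_exact_strongly_nondegenerate :
  argmin f (M `&` Q) !=set0 -> globally_exact f phi M Q ->
  strongly_nondegenerate f phi M Q.
Proof.
move=> [x ax] [c0 [c00 ec]]; exists c0; split=> //; split.
  by move=> c /ec ->; exists x.
exists (cst x); split.
- by move=> c /ec ->.
- exists `|x|%R; split; first exact: num_real.
  by move=> r xr _ [c _ <-]; exact: ltW.
- have -> : (fun c : R => dist (cst x c) (M `&` Q)) = cst 0.
    apply/funext => c; apply/eqP; rewrite eq_le; apply/andP; split.
      by apply: ereal_inf_lbound; exists x; [exact: ax.1|rewrite subrr normr0].
    by apply: le_ereal_inf_tmp => _ [y _ <-]; rewrite lee_fin.
  exact: cvg_cst.
Qed.

Lemma globally_exact_uniformly_locally_exact :
  globally_exact f phi M Q -> uniformly_locally_exact f phi M Q.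
Proof.
move=> [c0 [c00 ec]].
have gmin x c y : argmin f (M `&` Q) x -> (c0 <= c)%R -> Q y ->
    penalty_fun f phi c x <= penalty_fun f phi c y.
  by move=> ax /ec ecc; move: ax; rewrite -ecc => -[_]; apply.
have param x : argmin f (M `&` Q) x -> local_exactness_params f phi Q x c0.
  move=> ax; split=> // c cc0; split; first exact: ax.1.2.
  by apply: filterE => y Qy; exact: gmin.
split=> [x ax|].
  split; last by exists c0; exact: param.
  by split; [exact: ax.1|apply: filterE => y; exact: ax.2].
exists (c0 + 1)%R, 1%R; split=> [||x ax]; [lra|by []|split].
  apply: (@le_lt_trans _ _ c0%:E); last by rewrite lte_fin; lra.
  by apply: ereal_inf_lbound; exists c0 => //; exact: param.
apply: ereal_sup_ubound; exists 1%R => //; split=> // y _ Qy c cc0.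
by apply: gmin => //; lra.
Qed.

Lemma minimizers_near_argmin (C e : R) :
  reflexive_space X -> weakly_seq_closed Q ->
  weakly_seq_lsc f -> weakly_seq_lsc phi ->
  weakly_LP_wellposed_ext f M Q -> strongly_nondegenerate f phi M Q ->
  (0 < e)%R ->
  exists (c : R) (x : X), [/\ (C <= c)%R, argmin (penalty_fun f phi c) Q x &
    dist x (argmin f (M `&` Q)) < e%:E].
Proof.
move=> rX Qcl flsc philsc [[x0 ax0] wp] [c0 [c00 [_ [xc [xcmin xcbnd xcdist]]]]] e0.
have [B [_ xcB]] := xcbnd.
pose cn (n : nat) : R := (c0 + n%:R)%R.
have cn_ge n : (c0 <= cn n)%R by rewrite lerDl.
have xcn_le n : (`|xc (cn n)| <= B + 1)%R.
  by apply: (xcB (B + 1)%R); [rewrite ltrDl|exists (cn n) => //; exact: cn_ge].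
have [n_ [x [n_ge vx]]] := bounded_weakly_cvg_subseq (xc \o cn) _ rX xcn_le.
pose v k := xc (cn (n_ k)).
have vmin k : argmin (penalty_fun f phi (cn (n_ k))) Q (v k) by exact: xcmin.
pose a : R := fine (optimal_value f (M `&` Q)).
have aE : optimal_value f (M `&` Q) = a%:E by rewrite /a fineK.
have Fva k : penalty_fun f phi (cn (n_ k)) (v k) <= a%:E.
  rewrite -aE (argmin_value _ _ _ ax0) -(penalty_feasible (cn (n_ k)) x0 ax0.1).
  exact: (vmin k).2 _ ax0.1.2.
have fva k : f (v k) <= a%:E.
  by apply: le_trans (Fva k); apply: le_penalty0; exact: le_trans (cn_ge _).
have Qx : Q x by apply: Qcl vx => k; exact: (vmin k).1.
have cnoo : cn (n_ k) @[k --> \oo] --> +oo%R.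
  apply/cvgryPge => A; near=> k.
  have Ak : (A <= k%:R)%R by near: k; exact: nbhs_infty_ger.
  apply: (le_trans Ak); apply: (@le_trans _ _ (n_ k)%:R); first by rewrite ler_nat.
  by rewrite lerDr.
have flow r : r%:E < f x -> \forall k \near \oo, r%:E < f (v k).
  by move=> rf; apply: lt_limn_einf; exact: lt_le_trans rf (flsc _ _ vx).
have cnge A : \forall k \near \oo, (A <= cn (n_ k))%R.
  by move/cvgryPge : cnoo; exact.
have phix : phi x = 0.
  apply/eqP; rewrite eq_le hphi.1 andbT leNgt; apply/negP => /lte_dense0[d d0 dphi].
  have phid : \forall k \near \oo, d%:E < phi (v k).
    by apply: lt_limn_einf; exact: lt_le_trans dphi (philsc _ _ vx).
  have [r rf] : exists r : R, r%:E < f x.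
    by case: (f x) (hf x) => [s||]// _; [exists (s - 1)%R; rewrite lte_fin; lra
      |exists 0%R; rewrite ltry].
  have [k [[cd fr] pd]] :=
    filter_ex (filterI (filterI (cnge ((a - r) / d)%R) (flow _ rf)) phid).
  have := Fva k; apply/negP; rewrite -ltNge /penalty_fun.
  move: cd; rewrite ler_pdivrMr// => cd.
  have c_ge0 : (0 <= cn (n_ k))%R by exact: le_trans (cn_ge _).
  apply: (@lt_le_trans _ _ (f (v k) + (cn (n_ k) * d)%:E)).
    apply: (@le_lt_trans _ _ (r%:E + (cn (n_ k) * d)%:E)).
      by rewrite -EFinD lee_fin; lra.
    by rewrite lteD2rE.
  by rewrite leeD2l// EFinM lee_wpmul2l ?lee_fin// ltW.
have Mx : M x by apply/(hphi.2 x Qx).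
have ax : a%:E <= f x by rewrite -aE; apply: ereal_inf_lbound; exists x.
have fv : f (v k) @[k --> \oo] --> optimal_value f (M `&` Q).
  have fvfin k : f (v k) \is a fin_num.
    by rewrite fin_numE gt_eqF//= lt_eqF// (le_lt_trans (fva k))// ltry.
  rewrite aE; apply/fine_cvgP; split; first exact: filterE.
  apply/cvgrPdist_lt => d d0.
  have /flow : (a - d)%:E < f x.
    by apply: lt_le_trans ax; rewrite lte_fin; lra.
  apply: filterS => k /=; have := fva k; rewrite -(fineK (fvfin k)).
  by rewrite lee_fin lte_fin ltr_norml /= => h1 h2; apply/andP; split; lra.
have dv : dist (v k) (M `&` Q) @[k --> \oo] --> 0.
  exact: (cvg_comp _ _ cnoo xcdist).
have dve : \forall k \near \oo, dist (v k) (argmin f (M `&` Q)) < e%:E.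
  have /fine_cvgP[dfin /cvgrPdist_lt/(_ _ e0) de] := wp _ fv dv.
  apply: filterS2 dfin de => k dfin.
  rewrite sub0r normrN /= -[X in _ -> X < _](fineK dfin) lte_fin.
  exact/le_lt_trans/ler_norm.
have [k [? ?]] := filter_ex (filterI (cnge C) dve).
by exists (cn (n_ k)), (v k).
Unshelve. all: by end_near. Qed.

Lemma nondegenerate_locally_exact_globally_exact :
  reflexive_space X -> weakly_seq_closed Q ->
  weakly_seq_lsc f -> weakly_seq_lsc phi ->
  weakly_LP_wellposed_ext f M Q -> strongly_nondegenerate f phi M Q ->
  uniformly_locally_exact f phi M Q -> globally_exact f phi M Q.
Proof.
move=> rX Qcl flsc philsc wp nd [_ [cs [rs [cs0 rs0 ule]]]].
have [c [x [csc xmin xd]]] := minimizers_near_argmin cs (rs / 2) rX Qcl flsc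
  philsc wp nd (divr_gt0 rs0 (ltr0Sn R 1)).
have [_ [y ay <-]] := ereal_inf_lt xd.
rewrite lte_fin => xy.
apply: (penalty_bound_globally_exact c) => [||z Qz].
- exact: le_trans (ltW cs0) csc.
- exact: wp.1.
- rewrite (argmin_value _ _ _ ay) -(penalty_feasible c y ay.1).
  apply: le_trans (xmin.2 _ Qz).
  have /ereal_sup_gt[_ [r [r0 hr] <-]] :
      (rs / 2)%:E < local_exactness_radius f phi Q y cs.
    by apply: lt_le_trans (ule y ay).2; rewrite lte_fin; lra.
  rewrite lte_fin => rsr; apply: hr => //; last exact: xmin.1.
  by rewrite /closed_ball_ /= distrC; lra.
Qed.

End Exactness.

Theorem theorem6 (R : realType) (X : completeNormedModType R)
    (M Q : set X) (f phi : X -> \bar R)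
    (hX : reflexive_space X)
    (hM : M !=set0) (hQ : Q !=set0) (hMQ : M `&` Q !=set0)
    (hf : forall x, (-oo < f x)%E)
    (hfstar : optimal_value f (M `&` Q) \is a fin_num)
    (hphi : infeasibility_measure M Q phi)
    (hQclosed : weakly_seq_closed Q)
    (hflsc : weakly_seq_lsc f) (hphilsc : weakly_seq_lsc phi)
    (hwp : weakly_LP_wellposed_ext f M Q) :
  globally_exact f phi M Q <->
  strongly_nondegenerate f phi M Q /\ uniformly_locally_exact f phi M Q.
Proof.
split=> [ge|[nd ule]].
  split; last exact: globally_exact_uniformly_locally_exact ge.
  by apply: globally_exact_strongly_nondegenerate ge; exact: hwp.1.
by apply: (nondegenerate_locally_exact_globally_exact M Q f phi).
Qed.
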